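(* Let $n,k,t\ge 1$ be integers and let $G$ be a graph on $n$ vertices with diameter two, with (vertex) connectivity $k$, and having a universal vertex (a vertex adjacent to every other vertex). Then the $t$-pebbling number of $G$ is $$\pi_t(G)=\max\{\,n+4t-k-2,\; n+2t-2\,\}.$$
   Context: Graphs are finite, simple and connected. The (vertex) connectivity of a non-complete graph is the minimum number of vertices whose deletion disconnects it. A configuration of pebbles on a graph $G$ is a function $C:V(G)\to\mathbb{N}=\{0,1,2,\dots\}$, where $C(v)$ is the number of pebbles on $v$; its size is $|C|=\sum_{v\in V(G)}C(v)$. A pebbling step from a vertex $u$ (with at least two pebbles) to a neighbor $v$ of $u$ reduces $C(u)$ by two and increases $C(v)$ by one. For a root vertex $r$ and a positive integer $t$, $C$ is $t$-fold $r$-solvable if some (possibly empty) sequence of pebbling steps results in at least $t$ pebbles on $r$ (pebbles initially on $r$ count). The number $\pi_t(G,r)$ is the minimum positive integer $m$ such that every configuration of size $m$ on $V(G)$ is $t$-fold $r$-solvable, and the $t$-pebbling number of $G$ is $\pi_t(G)=\max_{r\in V(G)}\pi_t(G,r)$. *)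

(* Defs.v *)
From mathcomp Require Import all_boot.

Set Implicit Arguments.
Unset Strict Implicit.
Unset Printing Implicit Defensive.

(* A finite simple graph is a symmetric irreflexive relation e on a finType. *)

Definition connected_in (T : finType) (e : rel T) (A : {set T}) : bool :=
  [forall x in A, forall y in A,
     connect [rel a b | [&& a \in A, b \in A & e a b]] x y].

Definition connected (T : finType) (e : rel T) : bool := connected_in e [set: T].

(* The length of a shortest path from x to y.  A shortest path has fewer than
   #|T| edges; the default #|T| is only reached when y is unreachable from x. *)
Definition dist (T : finType) (e : rel T) (x y : T) : nat :=
  \big[minn/#|T|]_(d < #|T| |
    [exists p : d.-tuple T, path e x p && (last x p == y)]) d.

Definition diameter (T : finType) (e : rel T) : nat :=
  \max_(x : T) \max_(y : T) dist e x y.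

Definition disconnects (T : finType) (e : rel T) (S : {set T}) : bool :=
  ~~ connected_in e (~: S).

(* The default #|T| is only reached for complete graphs, which no deletion of
   vertices disconnects. *)
Definition connectivity (T : finType) (e : rel T) : nat :=
  \big[minn/#|T|]_(S : {set T} | disconnects e S) #|S|.

Definition universal_vertex (T : finType) (e : rel T) (u : T) : bool :=
  [forall v, (v != u) ==> e u v].

Definition config_size (T : finType) (C : {ffun T -> nat}) : nat :=
  \sum_(v : T) C v.

Definition move (T : finType) (C : {ffun T -> nat}) (u v : T) : {ffun T -> nat} :=
  [ffun w => C w - 2 * (w == u) + (w == v)].

Definition pebbling_step (T : finType) (e : rel T) : rel {ffun T -> nat} :=
  fun C C' => [exists u, exists v, [&& e u v, 2 <= C u & C' == move C u v]].

Definition solvable (T : finType) (e : rel T) (t : nat) (r : T)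
    (C : {ffun T -> nat}) : Prop :=
  exists2 s : seq {ffun T -> nat},
    path (pebbling_step e) C s & t <= last C s r.

Definition all_solvable (T : finType) (e : rel T) (t : nat) (r : T) (m : nat) : Prop :=
  forall C : {ffun T -> nat}, config_size C = m -> solvable e t r C.

(* m = pi_t(G, r) *)
Definition is_rooted_pebbling_number (T : finType) (e : rel T) (t : nat) (r : T)
    (m : nat) : Prop :=
  [/\ 0 < m, all_solvable e t r m
    & forall m', 0 < m' -> all_solvable e t r m' -> m <= m'].

(* m = pi_t(G); in particular, pi_t(G, r) exists for every root r. *)
Definition is_pebbling_number (T : finType) (e : rel T) (t m : nat) : Prop :=
  exists2 f : T -> nat,
    forall r, is_rooted_pebbling_number e t r (f r) & m = \max_(r : T) f r.

(* Main.v *)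
Require Import Defs.
From mathcomp Require Import all_boot zify.
From Stdlib Require Import Classical_Prop.

(* Lower bounds: place 2t-1 pebbles on one vertex other than the root, none on
   the root and one elsewhere; or take a minimum cut S, a root r on one side
   and place 4t-1 pebbles on a vertex of the other side, none on r and S, and
   one elsewhere. A potential that no pebbling step increases shows that t
   pebbles never reach r.
   Upper bound: let u be universal. A pebble that reaches an odd vertex makes a
   new pair there, so pairs can be forwarded without loss along disjoint paths
   of odd vertices; the other pairs are gathered on u. Since u lies in every
   cut, a Hall-type transport theorem, whose condition is verified on the
   boundary of a vertex set separated from r, produces enough disjoint paths
   (at least k-1 minus the number of even vertices, unless every pair can
   already be forwarded). *)

Set Implicit Arguments.
Unset Strict Implicit.
Unset Printing Implicit Defensive.

(** * Sums and counts over finite types *)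

(** Turns a comparison of totals into a pointwise equality; it shows below that a transport using up
    the total capacity saturates every capacity. *)
Lemma eq_from_leq_sum (T : finType) (f g : T -> nat) :
  (forall v, f v <= g v) -> \sum_v g v <= \sum_v f v -> f =1 g.
Proof.
move=> fg gf v; apply/eqP; rewrite eqn_leq fg leqNgt /=; apply: contraL gf => lt.
rewrite -ltnNge (bigD1 v) //= [X in _ < X](bigD1 v) //=.
have : \sum_(i | i != v) f i <= \sum_(i | i != v) g i by apply: leq_sum.
by lia.
Qed.

Lemma sum_setUI (T : finType) (F : T -> nat) (A B : {set T}) :
  \sum_(v in A :|: B) F v + \sum_(v in A :&: B) F v
  = \sum_(v in A) F v + \sum_(v in B) F v.
Proof.
rewrite ![\sum_(_ in _) _]big_mkcond -!big_split; apply: eq_bigr => v _ /=.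
by rewrite !inE; do 2!case: (v \in _) => /=; lia.
Qed.

Lemma leq_sum_subset (T : finType) (F : T -> nat) (A B : {set T}) :
  A \subset B -> \sum_(v in A) F v <= \sum_(v in B) F v.
Proof. by move=> /setIidPr AB; rewrite [leqRHS](big_setID A) /= AB leq_addr. Qed.

Lemma sum_decr (T : finType) (F : T -> nat) (A : {set T}) a : 0 < F a ->
  \sum_(v in A) (F v - (v == a)) + (a \in A) = \sum_(v in A) F v.
Proof.
move=> Fa; have [aA|aA] := boolP (a \in A).
  rewrite !(bigD1 a aA) /= eqxx (eq_bigr F) => [|v /andP[_ /negPf ->]]; lia.
rewrite addn0; apply: eq_bigr => v vA.
by case: eqP vA aA => [-> ->|_ _ _] //; rewrite subn0.
Qed.

Lemma sum_split2 (T : finType) (F : T -> nat) a b : a != b ->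
  \sum_v F v = F a + (F b + \sum_(v | (v != a) && (v != b)) F v).
Proof. by move=> ab; rewrite (bigD1 a) //= (bigD1 b) //= eq_sym. Qed.

Lemma sum_count (S T : finType) (h : S -> T) (M : seq S) :
  \sum_v count (fun p => h p == v) M = size M.
Proof.
elim: M => [|p M IH] /=; first by rewrite big1.
rewrite big_split /= IH (bigD1 (h p)) //= eqxx big1 // => v.
by rewrite eq_sym => /negPf ->.
Qed.

(** * An integral Hall theorem *)

Definition nbhd (S T : finType) (g : S -> T -> bool) (Q : {set S}) : {set T} :=
  [set w | [exists v in Q, g v w]].

Lemma nbhdS (S T : finType) (g : S -> T -> bool) (A B : {set S}) :
  A \subset B -> nbhd g A \subset nbhd g B.
Proof.
move=> AB; apply/subsetP => w; rewrite !inE => /exists_inP[v vA vw].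
by apply/exists_inP; exists v => //; apply: (subsetP AB).
Qed.

Lemma nbhdU (S T : finType) (g : S -> T -> bool) (A B : {set S}) :
  nbhd g (A :|: B) = nbhd g A :|: nbhd g B.
Proof.
apply/eqP; rewrite eqEsubset subUset !nbhdS ?subsetUl ?subsetUr // !andbT.
apply/subsetP => w; rewrite !inE => /exists_inP[v]; rewrite inE.
by case/orP=> vQ vw; apply/orP; [left|right]; apply/exists_inP; exists v.
Qed.

(* Integral form of Hall's theorem with supplies [s] and capacities [c]. The
   sets for which the Hall condition is an equality are closed under union, so
   the union U of those avoiding a given source v0 is one of them, and v0 can
   safely send one unit outside the neighbourhood of U. *)
Lemma transport (S T : finType) (g : S -> T -> bool) (s : S -> nat) (c : T -> nat) :
  (forall Q : {set S}, \sum_(v in Q) s v <= \sum_(w in nbhd g Q) c w) ->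
  exists M : seq (S * T),
    [/\ all (fun p => g p.1 p.2) M,
        forall v, count (fun p => p.1 == v) M = s v
      & forall w, count (fun p => p.2 == w) M <= c w].
Proof.
have [n] := ubnP (\sum_v s v).
elim: n s c => // n IHn s c sn hall.
have [/existsP[v0 sv0]|/existsPn s0] := boolP [exists v, 0 < s v]; last first.
  by exists [::]; split=> // v; have := s0 v; rewrite lt0n negbK => /eqP.
pose tight (Q : {set S}) := \sum_(v in Q) s v == \sum_(w in nbhd g Q) c w.
have tightU A B : tight A -> tight B -> tight (A :|: B).
  rewrite /tight => /eqP tA /eqP tB; rewrite eqn_leq hall /=.
  (* Uncrossing: the neighbourhood of the intersection lies in the intersection of the
     neighbourhoods, and [hall] applies to it. *)
  have := hall (A :&: B); have := sum_setUI s A B.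
  have := sum_setUI c (nbhd g A) (nbhd g B); rewrite -nbhdU.
  suff : \sum_(w in nbhd g (A :&: B)) c w <= \sum_(w in nbhd g A :&: nbhd g B) c w.
    by lia.
  by apply: leq_sum_subset; rewrite subsetI !nbhdS ?subsetIl ?subsetIr.
pose U := \bigcup_(Q | tight Q && (v0 \notin Q)) Q.
have /andP[tU v0U] : tight U && (v0 \notin U).
  apply: (big_ind (fun Q => tight Q && (v0 \notin Q))) => //.
    rewrite inE andbT /tight big_set0 eq_sym big1 // => w.
    by rewrite inE => /exists_inP[v]; rewrite inE.
  move=> A B /andP[tA nA] /andP[tB nB].
  by rewrite tightU // inE negb_or nA.
have [w [v0w wU cw]] : exists w, [/\ g v0 w, w \notin nbhd g U & 0 < c w].
  (* Otherwise [v0 |: U] would violate [hall]: adding [v0] to the tight set [U] raises the supply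
     but not the capacity. *)
  have [/existsP[w /and3P[]]|/existsPn none] :=
    boolP [exists w, [&& g v0 w, w \notin nbhd g U & 0 < c w]]; first by exists w.
  have := hall (v0 |: U); rewrite big_setU1 //= nbhdU.
  have := sum_setUI c (nbhd g [set v0]) (nbhd g U).
  rewrite [X in _ = X + _](big_setID (nbhd g U)) /= => sUI.
  suff : \sum_(w in nbhd g [set v0] :\: nbhd g U) c w = 0.
    by move/eqP: tU; lia.
  apply: big1 => w; rewrite !inE => /andP[wU /exists_inP[v]].
  rewrite inE => /eqP-> v0w; have := none w.
  by rewrite v0w inE wU /= lt0n negbK => /eqP.
have hall' (Q : {set S}) : \sum_(v in Q) (s v - (v == v0)) <=
               \sum_(x in nbhd g Q) (c x - (x == w)).
  have := sum_decr Q sv0; have := sum_decr (nbhd g Q) cw; have := hall Q.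
  have [v0Q|v0Q] := boolP (v0 \in Q).
    suff -> : w \in nbhd g Q by lia.
    by rewrite inE; apply/exists_inP; exists v0.
  have [wQ|] := boolP (w \in nbhd g Q); last by lia.
  (* Here the capacity drops but the supply does not, so [hall] must be strict at [Q]; a tight [Q]
     would lie in [U]. *)
  suff : ~~ tight Q by rewrite /tight; lia.
  apply: contra wU => tQ; have QU : Q \subset U by apply: bigcup_sup; rewrite tQ.
  exact: (subsetP (nbhdS g QU)).
have [|M [gM Ms Mc]] := IHn _ _ _ hall'.
  have eT (F : S -> nat) : \sum_(v in [set: S]) F v = \sum_v F v.
    by apply: eq_bigl => v; rewrite inE.
  by have := sum_decr setT sv0; rewrite inE !eT; lia.
exists ((v0, w) :: M); split=> /= [|v|x]; first by rewrite v0w.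
  by rewrite Ms eq_sym; case: eqP => [->|_]; lia.
have := Mc x; rewrite (eq_sym w); case: (x =P w) => [->|_] /=; lia.
Qed.

(** * Executing moves, monotonicity and potentials *)

(* Execute the moves in any feasible order. If no remaining move is feasible,
   every vertex has at least as many incoming as outgoing moves, hence exactly
   as many, so that none of them enters [r]. *)
Lemma flow_solvable (T : finType) (e : rel T) t r (C : {ffun T -> nat})
    (M : seq (T * T)) :
  all (fun p => e p.1 p.2) M ->
  (forall v, 2 * count (fun p => p.1 == v) M <= C v + count (fun p => p.2 == v) M) ->
  count (fun p => p.1 == r) M = 0 ->
  t <= C r + count (fun p => p.2 == r) M ->
  solvable e t r C.
Proof.
have [n] := ubnP (size M); elim: n M C => // n IHn M C Mn eM bal outr tr.
have [/hasP[[a b] abM /= Ca]|/hasPn stuck] := boolP (has (fun p => 1 < C p.1) M).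
  have [M' pM] : exists M' : seq (T * T), perm_eq M ((a, b) :: M').
    by exists (rem (a, b) M); apply: perm_to_rem.
  have cM P : count P M = P (a, b) + count P M' by rewrite (permP pM).
  have eab : e a b by exact: (allP eM _ abM).
  have aMr : (a == r) = false.
    by apply/eqP => ar; move: outr; rewrite cM /= ar eqxx.
  have [|||||s sC' tC'] := IHn M' (move C a b).
  - by move: Mn; rewrite (perm_size pM).
  - by move: eM; rewrite (perm_all _ pM) => /andP[].
  - move=> v; have := bal v; rewrite !cM /= ffunE (eq_sym v a) (eq_sym v b).
    by case: (eqVneq a v) Ca => [->|_]; lia.
  - by move: outr; rewrite cM /=; lia.
  - by move: tr; rewrite cM /= ffunE (eq_sym r a) aMr (eq_sym r b); lia.
  exists (move C a b :: s) => //=; rewrite sC' andbT.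
  by apply/existsP; exists a; apply/existsP; exists b; rewrite eab Ca eqxx.
exists [::] => //=; suff : count (fun p => p.2 == r) M = 0 by lia.
rewrite -outr; apply/esym.
apply: (@eq_from_leq_sum _ (fun v => count (fun p => p.1 == v) M)
                           (fun v => count (fun p => p.2 == v) M)) => [v|];
  last by rewrite !sum_count.
(* A stuck vertex with an outgoing move holds at most one pebble, so its balance forces at least as
   many incoming moves. *)
have [/hasP[p pM /eqP pv]|] := boolP (has (fun p => p.1 == v) M).
  by have := stuck p pM; rewrite pv; have := bal v; lia.
by rewrite has_count -leqNgt leqn0 => /eqP ->.
Qed.

(** Extra pebbles never invalidate a move, so the same moves can be replayed. *)
Lemma path_mono (T : finType) (e : rel T) (C C' : {ffun T -> nat}) s :
  (forall v, C v <= C' v) -> path (pebbling_step e) C s ->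
  exists2 s', path (pebbling_step e) C' s' & forall v, last C s v <= last C' s' v.
Proof.
elim: s C C' => [|D s IHs] C C' CC' /=; first by exists [::].
case/andP=> /existsP[a /existsP[b /and3P[eab Ca /eqP->]]].
have CC'1 v : move C a b v <= move C' a b v.
  by rewrite !ffunE; have := CC' v; lia.
case/(IHs _ _ CC'1) => s' ps' le.
exists (move C' a b :: s') => //=; rewrite ps' andbT.
apply/existsP; exists a; apply/existsP; exists b.
by rewrite eab eqxx (leq_trans Ca).
Qed.

Lemma solvable_mono (T : finType) (e : rel T) t r (C C' : {ffun T -> nat}) :
  (forall v, C v <= C' v) -> solvable e t r C -> solvable e t r C'.
Proof.
move=> CC' [s sC tr]; have [s' sC' le] := path_mono CC' sC.
by exists s' => //; apply: leq_trans (le r).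
Qed.

Lemma subconfig (T : finType) (C : {ffun T -> nat}) m : m <= config_size C ->
  exists2 C' : {ffun T -> nat}, config_size C' = m & forall v, C' v <= C v.
Proof.
elim: m => [|m IHm] mC.
  by exists [ffun=> 0] => [|v]; rewrite ?ffunE // /config_size big1 // => v; rewrite ffunE.
have [C' szC' CC'] := IHm (ltnW mC).
have [/existsP[a Ca]|/existsPn none] := boolP [exists a, C' a < C a].
  exists [ffun v => C' v + (v == a)] => [|v]; rewrite ?ffunE.
    rewrite -szC' /config_size (eq_bigr (fun v => C' v + (v == a))) => [|v _];
      last by rewrite ffunE.
    rewrite big_split /= (bigD1 a) //= [in X in _ + X](bigD1 a) //= eqxx.
    by rewrite [\sum_(_ | _) (_ == _)]big1; [lia|move=> v /negPf->].
  by have := CC' v; case: (v =P a) => [->|]; lia.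
move: mC; rewrite -szC' /config_size ltnNge leq_sum // => v _.
by rewrite leqNgt.
Qed.

Lemma all_solvable_mono (T : finType) (e : rel T) t r m m' :
  m <= m' -> all_solvable e t r m -> all_solvable e t r m'.
Proof.
move=> mm' solm C szC; have [|C' szC' CC'] := @subconfig _ C m; first by rewrite szC.
exact: solvable_mono CC' (solm C' szC').
Qed.

(** [F v m] is the weight of [m] pebbles on [v]: the total stays at most [b], whereas [t] pebbles on
    [r] alone weigh more. *)
Lemma potential_unsolvable (T : finType) (e : rel T) t r (C : {ffun T -> nat})
    (F : T -> nat -> nat) b :
  (forall a b (C : {ffun T -> nat}), e a b -> 1 < C a ->
     \sum_v F v (move C a b v) <= \sum_v F v (C v)) ->
  (forall m, t <= m -> b < F r m) ->
  \sum_v F v (C v) <= b -> ~ solvable e t r C.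
Proof.
move=> step Fr FC [s]; elim: s C FC => [|D s IHs] C FC /=.
  by move=> _ /Fr; rewrite ltnNge (leq_trans _ FC) // (bigD1 r) //= leq_addr.
case/andP=> /existsP[x /existsP[y /and3P[exy Cx /eqP->]]].
by apply: IHs; apply: leq_trans FC; apply: step.
Qed.

Lemma sum_move (T : finType) (F : T -> nat -> nat) (C : {ffun T -> nat}) a b :
  a != b -> F a (C a - 2) + F b (C b).+1 <= F a (C a) + F b (C b) ->
  \sum_v F v (move C a b v) <= \sum_v F v (C v).
Proof.
move=> ab le; rewrite !(sum_split2 _ ab) !ffunE !eqxx (negPf ab) eq_sym (negPf ab) /=.
rewrite (eq_bigr (fun v => F v (C v))) => [|v /andP[/negPf va /negPf vb]]; last first.
  by rewrite ffunE va vb muln0 subn0 addn0.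
by move: le; rewrite muln1 addn0 muln0 subn0 addn1; lia.
Qed.

(** * Cuts, diameter and connectivity *)

Lemma bigmin_inf (I : finType) d (P : pred I) (F : I -> nat) i :
  P i -> \big[minn/d]_(j | P j) F j <= F i.
Proof.
move=> Pi; have := mem_index_enum i; elim: (index_enum I) => // j s IHs.
rewrite inE big_cons => /predU1P[<-|/IHs le]; first by rewrite Pi geq_minl.
by case: ifP => // _; rewrite geq_min le orbT.
Qed.

Lemma bigmin_attained (I : finType) d (P : pred I) (F : I -> nat) :
  \big[minn/d]_(j | P j) F j = d \/
  exists2 i, P i & \big[minn/d]_(j | P j) F j = F i.
Proof.
elim/big_rec: _ => [|i m Pi IH]; first by left.
by case: (leqP (F i) m) => _ //; right; exists i.
Qed.

(** A walk that avoids [S] and starts in [A] can never leave [A]. *)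
Lemma closed_disconnects (T : finType) (e : rel T) (S A : {set T}) a b :
  a \in A -> a \notin S -> b \notin A -> b \notin S ->
  (forall x y, x \in A -> e x y -> y \notin S -> y \in A) -> disconnects e S.
Proof.
move=> aA aS bA bS clA; apply/negP => /forall_inP/(_ a); rewrite inE => /(_ aS).
move/forall_inP/(_ b); rewrite inE => /(_ bS)/connectP[p].
elim: p a aA {aS} => [|x p IHp] a aA /=; first by move=> _ ba; rewrite ba aA in bA.
case/andP=> /and3P[_]; rewrite inE => xS ax; exact/IHp/(clA a).
Qed.

(** Take for [A] the component of [a] after the deletion of [S]. *)
Lemma disconnects_closed (T : finType) (e : rel T) (S : {set T}) :
  disconnects e S -> exists (A : {set T}) a b,
    [/\ a \in A, b \notin A, b \notin S, [disjoint A & S]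
      & forall x y, x \in A -> e x y -> y \notin S -> y \in A].
Proof.
move=> /forall_inPn[a]; rewrite inE => aS /forall_inPn[b]; rewrite inE => bS nab.
set R := (X in connect X) in nab.
exists [set x in ~: S | connect R a x], a, b; split=> //.
- by rewrite !inE aS connect0.
- by rewrite !inE (negPf nab) andbF.
- by rewrite disjoints_subset; apply/subsetP => x; rewrite !inE => /andP[].
move=> x y; rewrite !inE => /andP[xS ax] xy yS; rewrite yS.
by apply: connect_trans ax (connect1 _); rewrite /R /= !inE xS yS.
Qed.

Lemma diameter_nonadjacent (T : finType) (e : rel T) :
  1 < diameter e -> exists x y, x != y /\ ~~ e x y.
Proof.
move=> d2.
have [/existsP[x /existsP[y /andP[xy nxy]]]|/existsPn adj] :=
  boolP [exists x, exists y, (x != y) && ~~ e x y]; first by exists x, y.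
move: d2; rewrite ltnNge => /negP[]; apply/bigmax_leqP => x _.
apply/bigmax_leqP => y _.
have T0 : 0 < #|T| by apply/card_gt0P; exists x.
case: (eqVneq x y) => [<-|xy].
  apply: leq_trans (leqnSn 0); apply: (@bigmin_inf _ _ _ _ (Ordinal T0)) => /=.
  by apply/existsP; exists [tuple] => /=.
(* The length 1 is an index of the minimum only if it is below [#|T|]. *)
have T1 : 1 < #|T| by apply/card_gt1P; exists x, y.
apply: (@bigmin_inf _ _ _ _ (Ordinal T1)) => /=.
apply/existsP; exists [tuple y] => /=; rewrite eqxx !andbT.
by have /existsPn/(_ y) := adj x; rewrite xy negbK.
Qed.

Lemma nonadjacent_disconnects (T : finType) (e : rel T) x y :
  irreflexive e -> x != y -> ~~ e x y -> disconnects e (~: [set x; y]).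
Proof.
move=> e_irr xy nxy; apply: (@closed_disconnects _ _ _ [set x] x y).
- by rewrite inE.
- by rewrite !inE eqxx.
- by rewrite inE eq_sym.
- by rewrite !inE eqxx orbT.
move=> a b; rewrite !inE negbK => /eqP-> xb /orP[|/eqP by_] //.
by rewrite by_ (negPf nxy) in xb.
Qed.

(** Deleting all but two nonadjacent vertices disconnects, which excludes the default value [#|T|],
    so the minimum is attained by a cut. *)
Lemma min_cut (T : finType) (e : rel T) : irreflexive e -> 1 < diameter e ->
  connectivity e + 2 <= #|T| /\
  exists2 S : {set T}, disconnects e S & #|S| = connectivity e.
Proof.
move=> e_irr /diameter_nonadjacent[x [y [xy nxy]]].
have dS := nonadjacent_disconnects e_irr xy nxy.
have cS : #|~: [set x; y]| + 2 = #|T|.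
  by have := cardsC [set x; y]; rewrite cards2 xy; lia.
have kS : connectivity e <= #|~: [set x; y]|.
  exact: (@bigmin_inf _ _ _ _ _ dS).
split; first by lia.
have [kT|[S SS kE]] := bigmin_attained #|T| (disconnects e) (fun S : {set T} => #|S|).
  by move: kS; rewrite {1}/connectivity kT; lia.
by exists S.
Qed.

(** * Upper bound *)

Lemma count_predIC (T : Type) (a b : pred T) s :
  count (predI a b) s + count (predI a (predC b)) s = count a s.
Proof. by elim: s => //= x s <-; case: (a x); case: (b x) => /=; lia. Qed.

(** Every pair outside [r] moves directly to [r], and at most [#|T| - 1] pebbles are left
    unpaired. *)
Lemma universal_root_solvable (T : finType) (e : rel T) t r (C : {ffun T -> nat}) :
  symmetric e -> universal_vertex e r ->
  #|T| + 2 * t <= config_size C + 2 -> solvable e t r C.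
Proof.
move=> e_sym /forallP ur szC.
pose s v := if v == r then 0 else (C v)./2.
pose c w := if w == r then \sum_v s v else 0.
have cr : c r = \sum_v s v by rewrite /c eqxx.
have sr : s r = 0 by rewrite /s eqxx.
have [Q|M [eM Ms Mc]] := @transport _ _ e s c.
  have [/exists_inP[v vQ vr]|/exists_inPn none] := boolP [exists v in Q, v != r].
    apply: (@leq_trans (\sum_v s v)).
      by rewrite big_mkcond leq_sum // => w _; case: ifP.
    have rQ : r \in nbhd e Q.
      by rewrite inE; apply/exists_inP; exists v; rewrite // e_sym; have := ur v; rewrite vr.
    by rewrite [leqRHS](bigD1 r rQ) /= cr leq_addr.
  by rewrite big1 // => v /none; rewrite negbK /s => ->.
have Mc' : (fun w => count (fun p => p.2 == w) M) =1 c.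
  apply: eq_from_leq_sum => //; rewrite sum_count.
  have <- : \sum_v s v = size M.
    by rewrite -(sum_count fst); apply: eq_bigr => v _; rewrite Ms.
  rewrite (bigD1 r) //= cr [X in _ + X]big1 ?addn0 // => w.
  by rewrite /c => /negPf->.
apply: (flow_solvable eM) => [v||].
- by rewrite Ms Mc' /s /c; case: eqP => _; lia.
- by rewrite Ms.
rewrite Mc' cr.
move: szC; rewrite /config_size (bigD1 r) //= [\sum_v s v](bigD1 r) //= sr.
have : \sum_(v | v != r) C v <= 2 * \sum_(v | v != r) s v + \sum_(v | v != r) 1.
  rewrite big_distrr -big_split leq_sum //= => v /negPf vr.
  by rewrite /s vr; lia.
have T0 : 0 < #|T| by apply/card_gt0P; exists r.
rewrite sum1_card cardC1. by move: T0; case: #|T| => // nT _; lia.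
Qed.

(* The pairs of pebbles on the vertices other than [r] and [u], together with
   the single pebbles left on odd vertices, are sent along edges: an odd vertex
   that receives a pebble can pass it on without loss, [y] pebbles reach [r]
   without passing through a pair on [u], and the other [x - y] are collected
   on [u]. A unit that the transport sends from a vertex to itself (a loop) is
   a pebble that does not move. *)
Lemma general_root_solvable (T : finType) (e : rel T) t r u (C : {ffun T -> nat}) :
  symmetric e -> universal_vertex e u -> r != u ->
  connectivity e + 2 <= #|T| ->
  #|T| + 4 * t <= config_size C + connectivity e + 2 ->
  #|T| + 2 * t <= config_size C + 2 ->
  solvable e t r C.
Proof.
move=> e_sym /forallP uu ru kT szk sz.
pose P v := (v != r) && (v != u).
have split (F : T -> nat) : \sum_v F v = F r + (F u + \sum_(v | P v) F v).
  by rewrite (sum_split2 _ ru).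
pose x := \sum_(v | P v) (C v)./2.
pose o := \sum_(v | P v) odd (C v).
pose z := \sum_(v | P v) ~~ odd (C v).
(* A cut avoiding [r] contains [u], hence at least [connectivity e - 1] vertices satisfying [P], of
   which at most [z] are even. *)
pose y := minn x (connectivity e - 1 - z).
pose s v := if P v then uphalf (C v) else 0.
pose c w := if w == r then y else if w == u then x - y else odd (C w).
pose g := [rel v w : T | (v == w) || e v w].
have Pr : P r = false by rewrite /P eqxx.
have Pu : P u = false by rewrite /P eqxx andbF.
have ur : (u == r) = false by rewrite eq_sym (negPf ru).
have cr : c r = y by rewrite /c eqxx.
have cu : c u = x - y by rewrite /c ur eqxx.
have cP w : P w -> c w = odd (C w) by rewrite /c => /andP[/negPf-> /negPf->].
have sP w : P w -> s w = (C w)./2 + odd (C w) by rewrite /s => ->; lia.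
have eu v : v != u -> e v u by move=> vu; rewrite e_sym; have := uu v; rewrite vu.
have hall (Q : {set T}) : \sum_(v in Q) s v <= \sum_(w in nbhd g Q) c w.
  have [/exists_inP[v0 v0Q Pv0]|/exists_inPn none] := boolP [exists v in Q, P v];
    last by rewrite big1 // => v /none /negPf Pv; rewrite /s Pv.
  set N := nbhd g Q.
  have QN v : v \in Q -> v \in N.
    by move=> vQ; rewrite inE; apply/exists_inP; exists v; rewrite //= eqxx.
  have eN v w : v \in Q -> e v w -> w \in N.
    by move=> vQ vw; rewrite inE; apply/exists_inP; exists v; rewrite //= vw orbT.
  have uN : u \in N by apply: (eN v0) => //; apply: eu; case/andP: Pv0.
  rewrite !(big_mkcond (fun v => v \in _)) !split /=.
  rewrite {1 2}/s Pr Pu !if_same !add0n uN cr cu.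
  have le1 : \sum_(v | P v) (if v \in Q then s v else 0) <=
             x + \sum_(v | P v) (v \in Q) * odd (C v).
    rewrite -big_split leq_sum //= => v Pv; rewrite sP //.
    by case: (v \in Q); rewrite ?mul1n.
  have le2 : \sum_(v | P v) (v \in Q) * odd (C v) <=
             \sum_(v | P v) (if v \in N then c v else 0).
    rewrite leq_sum // => v Pv; rewrite cP //.
    by case: (boolP (v \in Q)) => [/QN->|_]; rewrite ?mul1n.
  (* If [r] lies in [N], the capacities of [r] and [u] add up to [x] and cover all pairs. *)
  case: ifP => [rN|/negbT rN]; first by move: le1 le2; lia.
  (* Now [N :\: Q] cuts [Q] off from [r] and contains [u]; its odd vertices make up for the capacity
     [y] missing at [r]. *)
  have uQ : u \notin Q by apply: contra rN => uQ; apply: (eN u) => //; rewrite e_sym eu.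
  have kN : connectivity e <= #|N :\: Q|.
    have dS : disconnects e (N :\: Q).
      apply: (@closed_disconnects _ _ _ Q v0 r) => //.
      - by rewrite inE v0Q.
      - exact: contra (QN r) rN.
      - by rewrite inE (negPf rN) andbF.
      by move=> a b aQ ab; rewrite inE (eN a b aQ ab) andbT negbK.
    exact: (@bigmin_inf _ _ _ _ _ dS).
  have le3 : \sum_(v | P v) (v \in N :\: Q) + \sum_(v | P v) (v \in Q) * odd (C v)
             <= z + \sum_(v | P v) (if v \in N then c v else 0).
    rewrite -!big_split leq_sum //= => v Pv; rewrite cP // inE.
    by case: (boolP (v \in Q)) => [/QN->|_]; case: (v \in N); case: odd.
  move: kN; rewrite -sum1_card big_mkcond split /= !in_setD.
  rewrite (negPf rN) andbF uN uQ /=.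
  rewrite (eq_bigr (fun v => v \in N :\: Q : nat)) => [|v _]; last by case: (v \in _).
  by move: le1 le2 le3; lia.
have [M [gM Ms Mc]] := transport hall.
(* Supplies and capacities both total [x + o]. *)
have Mc' : (fun w => count (fun p => p.2 == w) M) =1 c.
  apply: eq_from_leq_sum => //; rewrite sum_count.
  have <- : \sum_v s v = size M.
    by rewrite -(sum_count fst); apply: eq_bigr => v _; rewrite Ms.
  rewrite !split {1 2}/s Pr Pu cr cu.
  rewrite (eq_bigr _ cP) (eq_bigr _ sP) big_split /= -/x -/o.
  by lia.
pose loop v := count (fun p => (p.1 == v) && (p.1 == p.2)) M.
(* The number of pairs on [u] once [x - y] pebbles have been gathered there; each pair yields one
   move to [r]. *)
pose h := (x - y + C u)./2.
pose M' := [seq p <- M | p.1 != p.2] ++ nseq h (u, r).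
have M's v : count (fun p => p.1 == v) M' + loop v = s v + (v == u) * h.
  rewrite count_cat count_nseq /= count_filter -Ms (eq_sym u).
  rewrite -(count_predIC (fun p => p.1 == v) (fun p => p.1 == p.2)) -/(loop v).
  rewrite [count (predI _ _) M in LHS](@eq_count _ _
    (predI (fun p => p.1 == v) (predC (fun p => p.1 == p.2)))) //.
  by lia.
have M'c v : count (fun p => p.2 == v) M' + loop v = c v + (v == r) * h.
  rewrite count_cat count_nseq /= count_filter -Mc' (eq_sym r).
  rewrite -(count_predIC (fun p => p.2 == v) (fun p => p.1 == p.2)).
  rewrite [count (predI _ (predC _)) M](@eq_count _ _
    (predI (fun p => p.2 == v) (fun p => p.1 != p.2))) //.
  rewrite [loop v](@eq_count _ _ (predI (fun p => p.2 == v) (fun p => p.1 == p.2))); first by lia.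
  by move=> [a b] /=; case: (eqVneq a b) => [->|]; rewrite ?andbF.
have sr : s r = 0 by rewrite /s Pr.
have su : s u = 0 by rewrite /s Pu.
apply: (@flow_solvable _ _ _ _ _ M') => [|v||].
- rewrite all_cat all_nseq /= e_sym eu // orbT andbT all_filter.
  by apply/allP => p /(allP gM) /= /orP[->|->] //; apply/implyP.
- have := M's v; have := M'c v; case: (boolP (P v)) => [Pv|].
    rewrite cP // sP //; move: Pv => /andP[/negPf-> /negPf->] /=; lia.
  rewrite negb_and !negbK => /orP[]/eqP->.
    by rewrite sr (negPf ru) /=; lia.
  by rewrite su cu eqxx ur /h /=; lia.
- by have := M's r; rewrite sr (negPf ru) /=; lia.
have := M'c r; have := M's r; rewrite sr cr eqxx (negPf ru) /=.
have szC : config_size C = C r + (C u + (2 * x + o)).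
  rewrite /config_size split /x /o big_distrr -big_split /=.
  by do 2!congr addn; apply: eq_bigr => v _; lia.
have szT : #|T| = o + z + 2.
  rewrite -sum1_card split /o /z -big_split /=.
  rewrite (eq_bigr (fun v => odd (C v) + ~~ odd (C v))) => [|v _]; last by case: odd.
  by rewrite addn2 !add1n.
(* If [y = x], the bound [sz] suffices; otherwise [y] is the truncated difference and [szk]
   suffices. *)
by rewrite /h; move: szk sz; rewrite szC szT; lia.
Qed.

(** * Lower bounds *)

Lemma unsolvable_star (T : finType) (e : rel T) t r : irreflexive e ->
  0 < t -> 1 < #|T| ->
  exists2 C : {ffun T -> nat}, config_size C + 3 = #|T| + 2 * t & ~ solvable e t r C.
Proof.
move=> e_irr t0 T1.
have /card_gt0P[v] : 0 < #|[set~ r]| by rewrite cardsC1; lia.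
rewrite !inE => vr.
pose C := [ffun w => if w == r then 0 else if w == v then 2 * t - 1 else 1].
have rv : r != v by rewrite eq_sym.
exists C.
  rewrite /config_size -sum1_card !(sum_split2 _ rv) !ffunE !eqxx (negPf vr).
  rewrite (eq_bigr (fun=> 1)) => [|w /andP[/negPf wr /negPf wv]]; first by lia.
  by rewrite ffunE wr wv.
(* Each pebble on [r] and each pair elsewhere weighs 1; the initial weight is [t - 1], all of it on
   [v]. *)
apply: (@potential_unsolvable _ _ _ _ _ (fun w m => if w == r then m else m./2) (t - 1)).
- move=> a b D eab Da; apply: (sum_move (F := fun w m => if w == r then m else m./2)).
    by apply: contraTneq eab => ->; rewrite e_irr.
  by do 2!case: eqP => _; lia.
- by move=> m tm; rewrite eqxx; lia.
rewrite (sum_split2 _ rv) !ffunE !eqxx (negPf vr) big1; first by lia.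
by move=> w /andP[/negPf wr /negPf wv]; rewrite ffunE wr wv.
Qed.

Lemma unsolvable_cut (T : finType) (e : rel T) t (S : {set T}) :
  symmetric e -> irreflexive e -> 0 < t -> disconnects e S ->
  exists r, exists2 C : {ffun T -> nat},
    config_size C + #|S| + 3 = #|T| + 4 * t & ~ solvable e t r C.
Proof.
move=> e_sym e_irr t0 /disconnects_closed[A [r [q [rA qA qS AS clA]]]].
have AnS x : x \in A -> x \notin S by apply: contraTN => xS; rewrite (disjointFl AS).
have rq : r != q by apply: contraNneq qA => <-.
have qr : (q == r) = false by rewrite eq_sym (negPf rq).
have rS := AnS r rA.
pose C := [ffun w => if (w == r) || (w \in S) then 0 else if w == q then 4 * t - 1 else 1].
exists r, C.
  have -> : #|T| = \sum_(v : T) ((v \in ~: S) + (v \in S)).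
    by rewrite -sum1_card; apply: eq_bigr => v _; rewrite inE; case: (v \in S).
  have -> : #|S| = \sum_v (v \in S).
    by rewrite -sum1_card big_mkcond; apply: eq_bigr => v _; case: (v \in S).
  rewrite big_split /= /config_size [\sum_v C v](sum_split2 _ rq).
  rewrite [\sum_v (v \in ~: S)](sum_split2 _ rq).
  rewrite !ffunE !inE !eqxx qr rS qS (negPf qS) /=.
  rewrite (eq_bigr (fun v => (v \in ~: S) : nat)) => [|v /andP[/negPf vr /negPf vq]]; first by lia.
  by rewrite ffunE vr vq inE; case: (v \in S).
(* A pebble of [r] or [S] weighs 2 or 1, and a pair elsewhere weighs 2 on the
   side of [r] and 1 on the other side. *)
pose F w m := if w == r then 2 * m else if w \in A then 2 * m./2 else
              if w \in S then m else m./2.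
apply: (@potential_unsolvable _ _ _ _ _ F (2 * t - 1)).
- move=> a b D eab Da; apply: sum_move.
    by apply: contraTneq eab => ->; rewrite e_irr.
  have loss : F a (D a - 2) + (if (a \in A) || (a \in S) then 2 else 1) <= F a (D a).
    move: Da; rewrite /F; case: eqP => [->|_]; first by rewrite rA /=; lia.
    by case: (a \in A); case: (a \in S) => /=; lia.
  have gain : F b (D b).+1 <= F b (D b) + (if b \in A then 2 else 1).
    rewrite /F; case: eqP => [->|_]; first by rewrite rA; lia.
    by case: (b \in A); case: (b \in S); lia.
  (* Only a pebble arriving in [A] can gain 2, and a move into [A] starts in [A] or [S], where the
     loss is at least 2. *)
  clearbody F; suff : b \in A -> (a \in A) || (a \in S).
    have [bA|/negPf bA] := boolP (b \in A); rewrite bA in gain => ab.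
      by rewrite (ab isT) in loss; lia.
    by move: loss; case: ifP => _ loss; lia.
  move=> bA; have [//|aS] := boolP (a \in S); first by rewrite orbT.
  by rewrite (clA b) // e_sym.
- by move=> m tm; rewrite /F eqxx; lia.
(* Initially only the pairs on [q] have weight, and there are [2 * t - 1] of them. *)
rewrite (sum_split2 _ rq) /F !ffunE !eqxx qr (negPf qS) (negPf qA) big1 /=; first by lia.
move=> w /andP[/negPf wr /negPf wq]; rewrite ffunE wr wq /=.
by case: (boolP (w \in A)) => [/AnS/negPf->|_]; case: (w \in S).
Qed.

(** * Existence of rooted numbers and the final equality *)

Lemma unsolvable_lt (T : finType) (e : rel T) t r (C : {ffun T -> nat}) m :
  ~ solvable e t r C -> all_solvable e t r m -> config_size C < m.
Proof.
move=> nC sm; rewrite ltnNge; apply/negP => mC; apply: nC.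
exact: all_solvable_mono mC sm _ erefl.
Qed.

(** Descent to a least size; the case split is classical because solvability is a proposition, not a
    boolean. *)
Lemma rooted_pebbling_number_exists (T : finType) (e : rel T) t r m :
  0 < m -> all_solvable e t r m -> exists m', is_rooted_pebbling_number e t r m'.
Proof.
elim/ltn_ind: m => m IHm m0 sm.
have [[m' [lt m'0 sm']]|none] :=
  classic (exists m', [/\ m' < m, 0 < m' & all_solvable e t r m']).
  exact: IHm lt m'0 sm'.
exists m; split=> // m' m'0 sm'; rewrite leqNgt; apply/negP => lt.
by apply: none; exists m'.
Qed.

Theorem theorem3 (n k t : nat) (T : finType) (e : rel T)
    (hn : 1 <= n) (hk : 1 <= k) (ht : 1 <= t)
    (e_sym : symmetric e) (e_irr : irreflexive e) (e_conn : connected e)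
    (card_T : #|T| = n) (diam2 : diameter e = 2) (conn_k : connectivity e = k)
    (univ : exists u : T, universal_vertex e u) :
  is_pebbling_number e t (maxn (n + 4 * t - k - 2) (n + 2 * t - 2)).
Proof.
have [|kn [S dS cS]] := min_cut e_irr; first by rewrite diam2.
rewrite conn_k card_T in kn cS.
set m := maxn _ _; have m0 : 0 < m by rewrite /m; lia.
have solm r : all_solvable e t r m.
  move=> C szC; case: univ => u uu; have [ru|ru] := eqVneq r u.
    by apply: universal_root_solvable => //; rewrite ?ru // card_T; lia.
  by apply: (general_root_solvable e_sym uu ru); rewrite ?conn_k card_T //; lia.
have [f fP] := fin_all_exists (fun r => rooted_pebbling_number_exists m0 (solm r)).
have fle r C : ~ solvable e t r C -> config_size C < \max_v f v.
  case: (fP r) => _ sf _ nC; apply: leq_trans (unsolvable_lt nC sf) _.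
  exact: leq_bigmax.
exists f => //; apply/eqP; rewrite eqn_leq; apply/andP; split; last first.
  by apply/bigmax_leqP => r _; case: (fP r) => _ _; apply.
(* The two unsolvable configurations have sizes one below the two terms of the maximum. *)
have [r [C szC /fle]] := unsolvable_cut e_sym e_irr ht dS.
have [|D szD /fle] := @unsolvable_star _ e t r e_irr ht; first by lia.
by rewrite /m; lia.
Qed.
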